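(* Consider the semi-discrete central-upwind scheme $$\frac{d}{dt}\overline{\bf W}_j=-\frac{{\bf H}_{j+\frac12}-{\bf H}_{j-\frac12}}{\Delta x}+\overline{\bf S}_j,\qquad {\bf W}=(A_1,Q_1,A_2,Q_2)^T,$$ described in the context, where the cell average $\overline{\bf S}_j$ of the source term $${\bf S}=\left(S_e,\ g\widehat w_2\partial_xA_1+S_{f,1}+S_eu_1,\ -rS_e,\ gw_2\partial_xA_2+S_{f,2}-rS_eu_2\right)^T$$ is discretized by $$\frac{g}{\Delta x}\int\widehat w_2\,\partial_xA_1\,dx\approx g\,\widehat w_{2,j}\frac{A_{1,j+\frac12}-A_{1,j-\frac12}}{\Delta x},\qquad \frac{g}{\Delta x}\int w_2\,\partial_xA_2\,dx\approx g\,\overline w_{2,j}\frac{A_{2,j+\frac12}-A_{2,j-\frac12}}{\Delta x},$$ $$\frac1{\Delta x}\int S_e\,dx\approx\frac{\overline A_{1,j}}{\sigma_{1,j}}V_e,\qquad \frac1{\Delta x}\int S_eu_k\,dx\approx\frac{\overline A_{1,j}}{\sigma_{1,j}}V_e\,\overline u_{k,j}\quad(k=1,2),$$ $$\frac1{\Delta x}\int S_{f,1}\,dx\approx-rg\frac{n_i^2\,\overline q_j}{\overline R_j^{4/3}}(\overline u_{1,j}-\overline u_{2,j})-g\frac{n_b^2\,\overline q_j}{\overline R_j^{4/3}}\overline u_{1,j},\qquad \frac1{\Delta x}\int S_{f,2}\,dx\approx-g\frac{n_i^2\,\overline q_j}{\overline R_j^{4/3}}(\overline u_{2,j}-\overline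 u_{1,j}),$$ all integrals being over the cell $[x_{j-\frac12},x_{j+\frac12}]$, with $$A_{k,j\pm\frac12}=\frac{a^+_{j\pm\frac12}A^-_{k,j\pm\frac12}-a^-_{j\pm\frac12}A^+_{k,j\pm\frac12}}{a^+_{j\pm\frac12}-a^-_{j\pm\frac12}}\ (k=1,2),\quad \overline q_j=\left|\frac{\overline Q_{1,j}\overline A_{1,j}+\overline Q_{2,j}\overline A_{2,j}}{\overline A_{1,j}+\overline A_{2,j}}\right|,\quad \overline R_j=\frac{\overline A_{1,j}+\overline A_{2,j}}{\sigma_{B_j}+\int_{B_j}^{\overline w_{2,j}}\sqrt{4+(\partial_z\sigma_j(z))^2}\,dz}.$$ Then the scheme satisfies the well-balance property, that is, it recognizes steady states of rest: if the cell averages at some time represent a steady state of rest, then $\frac{d}{dt}\overline{\bf W}_j=0$ for all $j$.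
   Context: The scheme approximates the two-layer shallow-water system in a channel with bottom $B(x)$ and width $\sigma(x,z)>0$ written as ${\bf W}_t+{\bf F}({\bf W})_x={\bf S}$, with ${\bf W}=(A_1,Q_1,A_2,Q_2)^T$ (wet areas and discharges of the internal layer 1 and external layer 2, $Q_k=A_ku_k$), $${\bf F}=\left(Q_1,\ \tfrac{Q_1^2}{A_1}+g\widehat w_2A_1,\ Q_2,\ \tfrac{Q_2^2}{A_2}+gw_2A_2\right)^T,$$ $w_1=B+h_1$, $w_2=w_1+h_2$, $\widehat w_2=w_1+rh_2$, where $h_1,h_2$ are layer depths, $g>0$, $0<r\le1$ the density ratio, $\epsilon=1-r$, $n_i,n_b\ge0$ Manning friction coefficients, $S_{f,k}$ the friction terms, $S_e=\frac{A_1}{\sigma_1}V_e$ the entrainment term with entrainment velocity $V_e$. Grid and geometry: cells $[x_{j-\frac12},x_{j+\frac12}]$ of length $\Delta x$ with center $x_j$; $B_{j+\frac12}=B(x_{j+\frac12})$; $B_j=\overline B_j=\frac12(B_{j+\frac12}+B_{j-\frac12})$; $\overline\sigma_j(z)=\frac12(\sigma(x_{j+\frac12},z)+\sigma(x_{j-\frac12},z))$; $\widetilde\sigma_j$ (also written $\sigma_j$) is the piecewise linear interpolant of $\overline\sigma_j$ on a uniform vertical grid $\{z_l\}$, and $\widetilde\sigma_{j+\frac12}$ that of $\sigma(x_{j+\frac12},\cdot)$. $\sigma_{B_j}$ and $\sigma_{1,j}$ are the cell widths at heights $B_j$ and $\overline w_{1,j}$. Heights: given cell averages $\overline A_{1,j},\overline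 A_{2,j}$, the heights $\overline w_{1,j},\overline w_{2,j}$ are determined by $\int_{B_j}^{\overline w_{1,j}}\widetilde\sigma_j\,dz=\overline A_{1,j}$ and $\int_{B_j}^{\overline w_{2,j}}\widetilde\sigma_j\,dz=\overline A_{1,j}+\overline A_{2,j}$. Set $\overline h_{2,j}=\overline w_{2,j}-\overline w_{1,j}$, $\widehat w_{2,j}=\overline w_{1,j}+r\overline h_{2,j}$, and $\overline u_{k,j}$ the cell velocity, equal to $\overline Q_{k,j}/\overline A_{k,j}$ (regularized for small areas; it is $0$ when $\overline Q_{k,j}=0$). Reconstruction: each of $w_1,w_2,Q_1,Q_2$ is reconstructed from cell values $\overline v_j$ by $p_j(x)=\overline v_j+v_j'(x-x_j)$ with $v_j'=\frac1{\Delta x}\mathrm{minmod}\left(\alpha(\overline v_j-\overline v_{j-1}),\tfrac12(\overline v_{j+1}-\overline v_{j-1}),\alpha(\overline v_{j+1}-\overline v_j)\right)$, $1\le\alpha<2$ (minmod returns the smallest argument if all are positive, the largest if all are negative, and $0$ otherwise), giving $v^-_{j+\frac12}=p_j(x_{j+\frac12})$ and $v^+_{j+\frac12}=p_{j+1}(x_{j+\frac12})$. A positivity correction modifies these values only in cells where a reconstructed $w_1$ falls below $B$ or a reconstructed $w_2$ falls below $w_1$ at an interface. The interface areas are $A^\pm_{1,j+\frac12}=\int_{B_{j+\frac12}}^{w^\pm_{1,j+\frac12}}\widetilde\sigma_{j+\frac12}\,dz$ and $A^\pm_{2,j+\frac12}=\int_{w^\pm_{1,j+\frac12}}^{w^\pm_{2,j+\frac12}}\widetilde\sigma_{j+\frac12}\,dz$.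 Interface velocities are $u_k^\pm=Q_k^\pm/A_k^\pm$, regularized for small areas (zero when $Q_k^\pm=0$). Numerical flux: $${\bf H}_{j+\frac12}=\frac{a^+{\bf F}({\bf W}^-)-a^-{\bf F}({\bf W}^+)}{a^+-a^-}+\frac{a^+a^-}{a^+-a^-}\left({\bf W}^+-{\bf W}^-\right)$$ with all quantities at $x_{j+\frac12}$, where $a^+=\max\{\gamma_1^+,\gamma_2^+,0\}$, $a^-=\min\{\gamma_1^-,\gamma_2^-,0\}$, evaluated at the reconstructed interface states, with $$\gamma_1^\pm=u_1\pm\sqrt{\sqrt r(1+\sqrt r)\tfrac{gA_1}{\sigma_2}+\epsilon\tfrac{gA_1}{\sigma_1}},\qquad \gamma_2^\pm=u_2\pm\sqrt{1+\sqrt r}\,\sqrt{\tfrac{gA_2}{\sigma_2}},$$ where $\sigma_1,\sigma_2$ are the channel widths at heights $w_1,w_2$. Steady state of rest: $u_1=u_2=0$, $w_1=B+h_1$ constant and $h_2$ constant (equivalently $w_1$ and $w_2$ constant), with both layers wet ($h_1,h_2>0$) and no entrainment ($V_e=0$). In terms of cell averages: $\overline Q_{1,j}=\overline Q_{2,j}=0$ and the recovered heights $\overline w_{1,j},\overline w_{2,j}$ are independent of $j$, with $B_{j\pm\frac12}<\overline w_{1,j}<\overline w_{2,j}$. *)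

(* Defs.v *)
From Stdlib Require Import Reals ZArith.
From Coquelicot Require Import Coquelicot.
Open Scope R_scope.

(** Cells are indexed by all of [Z], and an interface index [i] stands for the
    point x_{i+1/2}; thus cell [j] lies between interfaces [j - 1] and [j]. *)

Record problem := Problem {
  B : R -> R;                      (* bottom topography *)
  width : R -> R -> R;             (* channel width at position x, height z *)
  width_pos : forall x z, 0 < width x z;
  g : R;
  g_pos : 0 < g;
  r : R;                           (* density ratio *)
  r_range : 0 < r <= 1;
  n_i : R;                         (* Manning coefficient, interface *)
  n_i_ge0 : 0 <= n_i;
  n_b : R;                         (* Manning coefficient, bottom *)
  n_b_ge0 : 0 <= n_b;
  x_origin : R;
  dx : R;
  dx_pos : 0 < dx;
  z_origin : R;
  dz : R;                          (* step of the vertical grid *)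
  dz_pos : 0 < dz;
  alpha : R;                       (* minmod parameter *)
  alpha_range : 1 <= alpha < 2
}.

(** A rule computing a velocity from an area and a discharge, regularized for
    areas up to some threshold. *)
Record velocity_rule := VelocityRule {
  vel :> R -> R -> R;
  vel_threshold : R;
  vel_threshold_ge0 : 0 <= vel_threshold;
  vel_exact : forall A Q, vel_threshold < A -> vel A Q = Q / A;
  vel_rest : forall A, vel A 0 = 0
}.

(** Vectors (A1, Q1, A2, Q2), with Coquelicot's normed module structure. *)
Definition vec4 : Type := (R * R * R * R)%type.
Definition area1 (W : vec4) : R := fst (fst (fst W)).
Definition disch1 (W : vec4) : R := snd (fst (fst W)).
Definition area2 (W : vec4) : R := snd (fst W).
Definition disch2 (W : vec4) : R := snd W.

Definition minmod (a b c : R) : R :=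
  if Rlt_dec 0 (Rmin a (Rmin b c)) then Rmin a (Rmin b c)
  else if Rlt_dec (Rmax a (Rmax b c)) 0 then Rmax a (Rmax b c)
  else 0.

Section Scheme.

Variable P : problem.

Definition x_face (i : Z) : R := x_origin P + (IZR i + 1 / 2) * dx P.
Definition x_center (j : Z) : R := x_origin P + IZR j * dx P.

Definition B_face (i : Z) : R := B P (x_face i).
Definition B_cell (j : Z) : R := (B_face j + B_face (j - 1)) / 2.

(** Piecewise linear interpolant on the nodes [z_origin + l * dz], [l : Z]. *)
Definition interpolant (f : R -> R) (z : R) : R :=
  let zl := z_origin P + IZR (Int_part ((z - z_origin P) / dz P)) * dz P in
  f zl + (f (zl + dz P) - f zl) / dz P * (z - zl).

Definition width_face (i : Z) : R -> R := interpolant (width P (x_face i)).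
Definition width_cell (j : Z) : R -> R :=
  interpolant (fun z => (width P (x_face j) z + width P (x_face (j - 1)) z) / 2).

Definition is_height (j : Z) (a w : R) : Prop :=
  RInt (width_cell j) (B_cell j) w = a.

(** The [w] such that [is_height j a w], unique because the width is positive. *)
Definition height (j : Z) (a : R) : R := iota (fun w : R => is_height j a w).

Definition w1_cell (W : Z -> vec4) (j : Z) : R := height j (area1 (W j)).
Definition w2_cell (W : Z -> vec4) (j : Z) : R := height j (area1 (W j) + area2 (W j)).
Definition w2hat_cell (W : Z -> vec4) (j : Z) : R :=
  w1_cell W j + r P * (w2_cell W j - w1_cell W j).

Definition slope (v : Z -> R) (j : Z) : R :=
  / dx P * minmod (alpha P * (v j - v (j - 1)%Z))
                  (1 / 2 * (v (j + 1)%Z - v (j - 1)%Z))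
                  (alpha P * (v (j + 1)%Z - v j)).

Definition recon (v : Z -> R) (j : Z) (x : R) : R :=
  v j + slope v j * (x - x_center j).

Record trace := Trace { tr_w1 : R; tr_w2 : R; tr_Q1 : R; tr_Q2 : R }.

Definition recon_trace (W : Z -> vec4) (j : Z) (x : R) : trace :=
  {| tr_w1 := recon (w1_cell W) j x;
     tr_w2 := recon (w2_cell W) j x;
     tr_Q1 := recon (fun k => disch1 (W k)) j x;
     tr_Q2 := recon (fun k => disch2 (W k)) j x |}.

Definition trace_west (W : Z -> vec4) (j : Z) : trace :=
  recon_trace W j (x_face (j - 1)).
Definition trace_east (W : Z -> vec4) (j : Z) : trace :=
  recon_trace W j (x_face j).

Definition needs_correction (W : Z -> vec4) (j : Z) : Prop :=
  tr_w1 (trace_west W j) < B_face (j - 1) \/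
  tr_w1 (trace_east W j) < B_face j \/
  tr_w2 (trace_west W j) < tr_w1 (trace_west W j) \/
  tr_w2 (trace_east W j) < tr_w1 (trace_east W j).

(** [edges W j] is the pair of (west, east) values finally used in cell [j].
    The correction is left arbitrary in the cells that need one. *)
Definition positivity_corrected (edges : (Z -> vec4) -> Z -> trace * trace) : Prop :=
  forall W j, ~ needs_correction W j ->
    edges W j = (trace_west W j, trace_east W j).

Definition face_vec (i : Z) (s : trace) : vec4 :=
  (RInt (width_face i) (B_face i) (tr_w1 s), tr_Q1 s,
   RInt (width_face i) (tr_w1 s) (tr_w2 s), tr_Q2 s).

Definition flux (i : Z) (s : trace) : vec4 :=
  let W := face_vec i s in
  let w2 := tr_w2 s in
  let w2hat := tr_w1 s + r P * (tr_w2 s - tr_w1 s) in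
  (disch1 W, disch1 W ^ 2 / area1 W + g P * w2hat * area1 W,
   disch2 W, disch2 W ^ 2 / area2 W + g P * w2 * area2 W).

Definition celerity1 (i : Z) (s : trace) : R :=
  let W := face_vec i s in
  sqrt (sqrt (r P) * (1 + sqrt (r P)) * (g P * area1 W / width_face i (tr_w2 s))
        + (1 - r P) * (g P * area1 W / width_face i (tr_w1 s))).
Definition celerity2 (i : Z) (s : trace) : R :=
  let W := face_vec i s in
  sqrt (1 + sqrt (r P)) * sqrt (g P * area2 W / width_face i (tr_w2 s)).

(** Velocity rules used in the cells and at the interfaces, and the values
    [edges] of the (corrected) reconstruction. *)
Variables u_cell u_face : velocity_rule.
Variable edges : (Z -> vec4) -> Z -> trace * trace.

Definition face_u1 (i : Z) (s : trace) : R :=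
  u_face (area1 (face_vec i s)) (disch1 (face_vec i s)).
Definition face_u2 (i : Z) (s : trace) : R :=
  u_face (area2 (face_vec i s)) (disch2 (face_vec i s)).

Definition gamma1_plus i s : R := face_u1 i s + celerity1 i s.
Definition gamma1_minus i s : R := face_u1 i s - celerity1 i s.
Definition gamma2_plus i s : R := face_u2 i s + celerity2 i s.
Definition gamma2_minus i s : R := face_u2 i s - celerity2 i s.

Definition minus_side (W : Z -> vec4) (i : Z) : trace := snd (edges W i).
Definition plus_side (W : Z -> vec4) (i : Z) : trace := fst (edges W (i + 1)%Z).

(** The local speeds are bounds over both one-sided states. *)
Definition a_plus (W : Z -> vec4) (i : Z) : R :=
  let sm := minus_side W i in let sp := plus_side W i in
  Rmax (Rmax (Rmax (gamma1_plus i sm) (gamma1_plus i sp))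
             (Rmax (gamma2_plus i sm) (gamma2_plus i sp))) 0.
Definition a_minus (W : Z -> vec4) (i : Z) : R :=
  let sm := minus_side W i in let sp := plus_side W i in
  Rmin (Rmin (Rmin (gamma1_minus i sm) (gamma1_minus i sp))
             (Rmin (gamma2_minus i sm) (gamma2_minus i sp))) 0.

Definition numerical_flux (W : Z -> vec4) (i : Z) : vec4 :=
  let ap := a_plus W i in
  let am := a_minus W i in
  let sm := minus_side W i in
  let sp := plus_side W i in
  plus (scal (/ (ap - am)) (minus (scal ap (flux i sm)) (scal am (flux i sp))))
       (scal (ap * am / (ap - am)) (minus (face_vec i sp) (face_vec i sm))).

(** [A] is [area1] or [area2]. *)
Definition face_area (A : vec4 -> R) (W : Z -> vec4) (i : Z) : R :=
  let ap := a_plus W i in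
  let am := a_minus W i in
  (ap * A (face_vec i (minus_side W i)) - am * A (face_vec i (plus_side W i)))
  / (ap - am).

Definition u1_cell (W : Z -> vec4) (j : Z) : R := u_cell (area1 (W j)) (disch1 (W j)).
Definition u2_cell (W : Z -> vec4) (j : Z) : R := u_cell (area2 (W j)) (disch2 (W j)).

Definition q_cell (W : Z -> vec4) (j : Z) : R :=
  Rabs ((disch1 (W j) * area1 (W j) + disch2 (W j) * area2 (W j)) / (area1 (W j) + area2 (W j))).

(** The width is piecewise linear in height, so [Derive] is the actual slope
    except at the grid nodes, which do not contribute to the integral. *)
Definition hydraulic_radius (W : Z -> vec4) (j : Z) : R :=
  (area1 (W j) + area2 (W j))
  / (width_cell j (B_cell j)
     + RInt (fun z => sqrt (4 + Derive (width_cell j) z ^ 2))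
            (B_cell j) (w2_cell W j)).

Definition manning (n : R) (W : Z -> vec4) (j : Z) : R :=
  g P * (n ^ 2 * q_cell W j / Rpower (hydraulic_radius W j) (4 / 3)).

Definition friction1 (W : Z -> vec4) (j : Z) : R :=
  - r P * manning (n_i P) W j * (u1_cell W j - u2_cell W j)
  - manning (n_b P) W j * u1_cell W j.
Definition friction2 (W : Z -> vec4) (j : Z) : R :=
  - manning (n_i P) W j * (u2_cell W j - u1_cell W j).

(** Below, [Ve j] is the entrainment velocity in cell [j]. *)
Definition entrainment (Ve : Z -> R) (W : Z -> vec4) (j : Z) : R :=
  area1 (W j) / width_cell j (w1_cell W j) * Ve j.

Definition source (Ve : Z -> R) (W : Z -> vec4) (j : Z) : vec4 :=
  let Se := entrainment Ve W j in
  (Se,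
   g P * w2hat_cell W j * ((face_area area1 W j - face_area area1 W (j - 1)) / dx P)
     + friction1 W j + Se * u1_cell W j,
   - r P * Se,
   g P * w2_cell W j * ((face_area area2 W j - face_area area2 W (j - 1)) / dx P)
     + friction2 W j - r P * (Se * u2_cell W j)).

Definition scheme_rhs (Ve : Z -> R) (W : Z -> vec4) (j : Z) : vec4 :=
  plus (opp (scal (/ dx P) (minus (numerical_flux W j) (numerical_flux W (j - 1)))))
       (source Ve W j).

(** The cell averages [W s j] (time [s], cell [j]) obey the scheme at time [t]. *)
Definition satisfies_scheme_at (Ve : R -> Z -> R) (W : R -> Z -> vec4) (t : R) : Prop :=
  forall j, is_derive (fun s => W s j) t (scheme_rhs (Ve t) (W t) j).

Definition at_rest (Ve : Z -> R) (W : Z -> vec4) : Prop :=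
  exists c1 c2 : R, forall j,
    disch1 (W j) = 0 /\ disch2 (W j) = 0 /\
    is_height j (area1 (W j)) c1 /\
    is_height j (area1 (W j) + area2 (W j)) c2 /\
    B_face (j - 1) < c1 /\ B_face j < c1 /\ c1 < c2 /\
    Ve j = 0.

End Scheme.

(* Main.v *)
(** At rest the recovered heights are two constants, the only heights with the
    given areas because the interpolated width is continuous and positive. All
    minmod slopes then vanish, no cell needs correction, and both sides of every
    interface carry the same state. The local speeds do not degenerate, since
    the wet upper layer has positive celerity, so the numerical flux is the exact
    flux there, and its jump over a cell is exactly the discretized pressure
    source. *)

Require Import Defs.
From Stdlib Require Import Reals ZArith Lra.
From Coquelicot Require Import Coquelicot.
Open Scope R_scope.

Section Interpolant.

Variable P : problem.
Variable f : R -> R.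

Lemma Int_part_IZR_bounds (x : R) :
  IZR (Int_part x) <= x < IZR (Int_part x) + 1.
Proof. pose proof (base_Int_part x); lra. Qed.

Lemma Int_part_eq (x : R) (n : Z) : IZR n <= x < IZR n + 1 -> Int_part x = n.
Proof. intros H; symmetry; apply Int_part_spec; lra. Qed.

Definition node (n : Z) : R := z_origin P + IZR n * dz P.

Lemma interpolant_eq (n : Z) (z : R) :
  node n <= z < node n + dz P ->
  interpolant P f z =
  f (node n) + (f (node n + dz P) - f (node n)) / dz P * (z - node n).
Proof.
  intros H; unfold interpolant, node in *; pose proof (dz_pos P) as Hd.
  rewrite (Int_part_eq _ n); [reflexivity|].
  split.
  - apply Rle_div_r; lra.
  - apply Rlt_div_l; lra.
Qed.

Lemma node_below (z : R) : exists n, node n <= z < node n + dz P.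
Proof.
  pose proof (dz_pos P) as Hd.
  exists (Int_part ((z - z_origin P) / dz P)).
  destruct (Int_part_IZR_bounds ((z - z_origin P) / dz P)) as [H1 H2].
  unfold node; apply Rle_div_r in H1; [|lra]; apply Rlt_div_l in H2; [|lra].
  lra.
Qed.

Lemma interpolant_pos (z : R) : (forall y, 0 < f y) -> 0 < interpolant P f z.
Proof.
  intros Hf; pose proof (dz_pos P) as Hd.
  destruct (node_below z) as [n Hn]; rewrite (interpolant_eq n z Hn).
  (* The relative position of [z] in its grid cell, lying in [0, 1): the interpolant is a convex
     combination of two nodal values. *)
  set (s := (z - node n) / dz P).
  replace (_ + _) with (f (node n) * (1 - s) + f (node n + dz P) * s)
    by (unfold s; field; lra).
  assert (0 <= s) by (unfold s; apply Rdiv_le_0_compat; lra).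
  assert (s < 1) by (unfold s; apply Rlt_div_l; lra).
  pose proof (Hf (node n)); pose proof (Hf (node n + dz P)); nra.
Qed.

(** Near the node below [z] the interpolant is affine on either side; absolute
    values merge the two pieces into one continuous expression. *)
Lemma interpolant_continuous (z : R) : continuous (interpolant P f) z.
Proof.
  pose proof (dz_pos P) as Hd.
  destruct (node_below z) as [n Hn].
  set (c := node n) in *.
  set (sr := (f (c + dz P) - f c) / dz P).
  set (sl := (f c - f (c - dz P)) / dz P).
  assert (Hprev : node (n - 1) = c - dz P)
    by (unfold c, node; rewrite minus_IZR; ring).
  apply continuous_ext_loc with
    (fun y => f c + (sr * ((y - c + Rabs (y - c)) / 2)
                     + sl * ((y - c - Rabs (y - c)) / 2))).
  (* Two adjacent grid cells form a neighbourhood of [z] even when [z] is the node [c] itself. *)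
  - apply (locally_interval _ z (c - dz P) (c + dz P)); simpl; try lra.
    intros y Hl Hr.
    destruct (Rle_lt_dec c y) as [Hy|Hy].
    + rewrite (interpolant_eq n y) by (fold c; lra).
      fold c sr; rewrite Rabs_right by lra; field.
    + rewrite (interpolant_eq (n - 1) y) by (rewrite Hprev; lra).
      rewrite Hprev; replace (c - dz P + dz P) with c by ring; fold sl.
      rewrite Rabs_left by lra; unfold sl; field; lra.
  - apply continuity_pt_filterlim; unfold Rdiv; reg.
Qed.

Lemma interpolant_ex_RInt (a b : R) : ex_RInt (interpolant P f) a b.
Proof. apply (@ex_RInt_continuous R_CompleteNormedModule); intros; apply interpolant_continuous. Qed.

Lemma interpolant_RInt_pos (a b : R) :
  (forall y, 0 < f y) -> a < b -> 0 < RInt (interpolant P f) a b.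
Proof.
  intros Hf Hab; apply RInt_gt_0; auto; intros.
  - now apply interpolant_pos.
  - apply interpolant_continuous.
Qed.

(** By Chasles the integral from [b] to [c] vanishes, which positivity forbids on a nondegenerate
    interval. *)
Lemma interpolant_RInt_inj (a b c : R) :
  (forall y, 0 < f y) ->
  RInt (interpolant P f) a b = RInt (interpolant P f) a c -> b = c.
Proof.
  intros Hf H.
  assert (E : RInt (interpolant P f) b c = 0).
  { pose proof (RInt_Chasles (interpolant P f) a b c
      (interpolant_ex_RInt _ _) (interpolant_ex_RInt _ _)) as E.
    unfold plus in E; simpl in E; lra. }
  destruct (Rtotal_order b c) as [Hbc|[Hbc|Hbc]]; [|exact Hbc|].
  - pose proof (interpolant_RInt_pos b c Hf Hbc); lra.
  - pose proof (interpolant_RInt_pos c b Hf Hbc).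
    rewrite <- opp_RInt_swap in E by apply interpolant_ex_RInt.
    unfold opp in E; simpl in E; lra.
Qed.

End Interpolant.

(** [iota] returns the intended value only under uniqueness, which is injectivity of the area in the
    height; the mean of the two face widths is positive. *)
Lemma height_eq (P : problem) (j : Z) (a w : R) :
  is_height P j a w -> height P j a = w.
Proof.
  intros H; unfold height; apply (@iota_unique R_AbsRing R_CompleteNormedModule); [|exact H].
  unfold is_height, width_cell in *; intros y Hy.
  refine (interpolant_RInt_inj _ _ _ _ _ _ (eq_trans Hy (eq_sym H))).
  intros z; pose proof (width_pos P (x_face P j) z).
  pose proof (width_pos P (x_face P (j - 1)) z); lra.
Qed.

Lemma minmod_000 : minmod 0 0 0 = 0.
Proof.
  unfold minmod; rewrite !(Rmin_left 0 0), !(Rmax_left 0 0) by lra.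
  destruct (Rlt_dec 0 0); lra.
Qed.

Lemma recon_const (P : problem) (v : Z -> R) (c : R) (j : Z) (x : R) :
  (forall k, v k = c) -> recon P v j x = c.
Proof.
  intros Hv; unfold recon, slope; rewrite !Hv, Rminus_diag, !Rmult_0_r, minmod_000.
  ring.
Qed.

Definition rest_trace (c1 c2 : R) : trace :=
  {| tr_w1 := c1; tr_w2 := c2; tr_Q1 := 0; tr_Q2 := 0 |}.

Lemma vec4_eq (a b c d a' b' c' d' : R) :
  a = a' -> b = b' -> c = c' -> d = d' -> (a, b, c, d) = (a', b', c', d') :> vec4.
Proof. now intros -> -> -> ->. Qed.

Section Vec4.

Variables (k a b c d a' b' c' d' : R).

(** These rules hold by computation and serve to rewrite the module operations on nested pairs into
    real components. *)
Lemma vec4_plus :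
  plus ((a, b, c, d) : vec4) (a', b', c', d') = (a + a', b + b', c + c', d + d').
Proof. reflexivity. Qed.

Lemma vec4_opp : opp ((a, b, c, d) : vec4) = (- a, - b, - c, - d).
Proof. reflexivity. Qed.

Lemma vec4_minus :
  minus ((a, b, c, d) : vec4) (a', b', c', d') = (a - a', b - b', c - c', d - d').
Proof. reflexivity. Qed.

Lemma vec4_scal : scal k ((a, b, c, d) : vec4) = (k * a, k * b, k * c, k * d).
Proof. reflexivity. Qed.

End Vec4.

Section Consistency.

Variables (P : problem) (u_face : velocity_rule).
Variable edges : (Z -> vec4) -> Z -> trace * trace.
Variables (W : Z -> vec4) (i : Z) (s : trace).
Hypothesis Hminus : minus_side edges W i = s.
Hypothesis Hplus : plus_side edges W i = s.
Hypothesis Hspeed : a_plus P u_face edges W i - a_minus P u_face edges W i <> 0.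

(** With equal states the diffusion term vanishes, and the weights of the two fluxes sum to one. *)
Lemma numerical_flux_consistent : numerical_flux P u_face edges W i = flux P i s.
Proof.
  unfold numerical_flux; rewrite Hminus, Hplus.
  (* The identity holds for arbitrary flux and state vectors, so both are generalised. *)
  destruct (flux P i s) as [[[x1 x2] x3] x4].
  destruct (face_vec P i s) as [[[y1 y2] y3] y4].
  rewrite !vec4_minus, !vec4_scal, !vec4_minus, vec4_scal, vec4_plus.
  apply vec4_eq; field; exact Hspeed.
Qed.

Lemma face_area_consistent (A : vec4 -> R) :
  face_area P u_face edges A W i = A (face_vec P i s).
Proof.
  unfold face_area; rewrite Hminus, Hplus; field; exact Hspeed.
Qed.

End Consistency.

Lemma celerity2_pos (P : problem) (i : Z) (s : trace) :
  tr_w1 s < tr_w2 s -> 0 < celerity2 P i s.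
Proof.
  intros Hs; unfold celerity2.
  pose proof (sqrt_pos (r P)).
  apply Rmult_lt_0_compat; apply sqrt_lt_R0; [lra|].
  apply Rdiv_lt_0_compat.
  - apply Rmult_lt_0_compat; [apply g_pos|].
    apply interpolant_RInt_pos; [intros; apply width_pos|exact Hs].
  - apply interpolant_pos; intros; apply width_pos.
Qed.

(** At zero discharge the velocity rule gives zero, so [gamma2_plus] is the positive celerity of
    layer 2; it bounds [a_plus] from below, while [a_minus] is at most 0 by definition. *)
Lemma speeds_apart (P : problem) (u_face : velocity_rule)
  (edges : (Z -> vec4) -> Z -> trace * trace) (W : Z -> vec4) (i : Z) (c1 c2 : R) :
  minus_side edges W i = rest_trace c1 c2 -> c1 < c2 ->
  a_plus P u_face edges W i - a_minus P u_face edges W i <> 0.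
Proof.
  intros Hm Hc.
  assert (Hpos : 0 < gamma2_plus P u_face i (minus_side edges W i)).
  { rewrite Hm; unfold gamma2_plus, face_u2; simpl; rewrite vel_rest, Rplus_0_l.
    now apply celerity2_pos. }
  assert (gamma2_plus P u_face i (minus_side edges W i) <= a_plus P u_face edges W i).
  { unfold a_plus; cbv zeta.
    eapply Rle_trans; [|apply Rmax_l].
    eapply Rle_trans; [|apply Rmax_r].
    apply Rmax_l. }
  assert (a_minus P u_face edges W i <= 0) by (unfold a_minus; apply Rmin_r).
  lra.
Qed.

(** The bounds on [c1] and [c2] exclude each alternative of [needs_correction], so the arbitrary
    correction never enters. *)
Lemma rest_edges (P : problem) (edges : (Z -> vec4) -> Z -> trace * trace)
  (W : Z -> vec4) (c1 c2 : R) (j : Z) :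
  positivity_corrected P edges ->
  (forall k, w1_cell P W k = c1) -> (forall k, w2_cell P W k = c2) ->
  (forall k, disch1 (W k) = 0) -> (forall k, disch2 (W k) = 0) ->
  B_face P (j - 1) < c1 -> B_face P j < c1 -> c1 < c2 ->
  edges W j = (rest_trace c1 c2, rest_trace c1 c2).
Proof.
  intros Hedges H1 H2 HQ1 HQ2 HBw HBe Hc.
  assert (Htr : forall x, recon_trace P W j x = rest_trace c1 c2).
  { intros x; unfold recon_trace, rest_trace.
    now rewrite (recon_const P _ c1), (recon_const P _ c2), !(recon_const P _ 0). }
  rewrite Hedges; unfold needs_correction, trace_west, trace_east; rewrite !Htr.
  - reflexivity.
  - simpl; lra.
Qed.

Lemma scheme_rhs_at_rest (P : problem) (u_cell u_face : velocity_rule)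
  (edges : (Z -> vec4) -> Z -> trace * trace) (Ve : Z -> R) (W : Z -> vec4) (j : Z) :
  positivity_corrected P edges -> at_rest P Ve W ->
  scheme_rhs P u_cell u_face edges Ve W j = (zero : vec4).
Proof.
  intros Hedges [c1 [c2 Hrest]].
  assert (H1 : forall k, w1_cell P W k = c1) by (intros; apply height_eq, Hrest).
  assert (H2 : forall k, w2_cell P W k = c2) by (intros; apply height_eq, Hrest).
  assert (HQ1 : forall k, disch1 (W k) = 0) by apply Hrest.
  assert (HQ2 : forall k, disch2 (W k) = 0) by apply Hrest.
  assert (Hc : c1 < c2) by apply (Hrest 0%Z).
  assert (He : forall k, edges W k = (rest_trace c1 c2, rest_trace c1 c2))
    by (intros; apply (rest_edges P); auto; apply Hrest).
  assert (Hm : forall i, minus_side edges W i = rest_trace c1 c2)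
    by (intros; unfold minus_side; now rewrite He).
  assert (Hp : forall i, plus_side edges W i = rest_trace c1 c2)
    by (intros; unfold plus_side; now rewrite He).
  assert (Hs : forall i, a_plus P u_face edges W i - a_minus P u_face edges W i <> 0)
    by (intros; apply speeds_apart with c1 c2; auto).
  assert (HVe : Ve j = 0) by apply Hrest.
  unfold scheme_rhs, source, friction1, friction2, entrainment, w2hat_cell.
  rewrite !(numerical_flux_consistent P u_face edges W _ (rest_trace c1 c2)) by auto.
  rewrite !(face_area_consistent P u_face edges W _ (rest_trace c1 c2)) by auto.
  (* Zero cell velocities remove friction whatever the value of the Manning factors, and [Ve j = 0]
     removes entrainment. *)
  unfold u1_cell, u2_cell; rewrite !HQ1, !HQ2, !vel_rest, H1, H2, HVe.
  unfold flux, face_vec, area1, disch1, area2, disch2; simpl.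
  rewrite vec4_minus, vec4_scal, vec4_opp, vec4_plus.
  (* The kinetic terms have become [0 / A], which is zero for any [A]. *)
  rewrite !Rmult_0_l, !Rdiv_0_l.
  (* Constant heights give the pressure flux at both faces and the source in the cell the same
     factor, so they cancel with [/ dx P] treated as an atom. *)
  change (zero : vec4) with (0, 0, 0, 0); apply vec4_eq; unfold Rdiv; ring.
Qed.

Theorem proposition7
  (P : problem) (u_cell u_face : velocity_rule)
  (edges : (Z -> vec4) -> Z -> trace * trace)
  (Hedges : positivity_corrected P edges)
  (Ve : R -> Z -> R) (W : R -> Z -> vec4) (t : R)
  (Hscheme : satisfies_scheme_at P u_cell u_face edges Ve W t)
  (Hrest : at_rest P (Ve t) (W t)) :
  forall j : Z, is_derive (fun s : R => W s j) t (zero : vec4).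
Proof.
  intros j.
  rewrite <- (scheme_rhs_at_rest P u_cell u_face edges (Ve t) (W t) j Hedges Hrest).
  apply Hscheme.
Qed.
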